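(* Let $n$ be a positive integer. The set $\Sigma_B$ of integer tuples $(p,q,k,l,m,\alpha,\beta)$ with $p,q,k,l,m\ge1$, $0\le\alpha<k+l+m$, $0\le\beta<m$ and $p(k+l+m)+qm=n$ uniquely parametrizes the $n$-square surfaces in $\mathcal H(1,1)$ with cylinder diagram $B$: every such surface is isomorphic to the surface with parameters $v$ for exactly one $v\in\Sigma_B$.
   Context: An $n$-square surface is a connected closed oriented surface obtained from $n$ unit axis-parallel squares by gluing right sides to left sides and top sides to bottom sides by translations; two are isomorphic if there is a bijection of their squares respecting right-neighbours and top-neighbours. It is in $\mathcal H(1,1)$ if it has exactly two cone points, each of angle $4\pi$. The surface with parameters $(p,q,k,l,m,\alpha,\beta)$: take two horizontal cylinders (rectangles with vertical sides identified), $C_1$ of circumference $k+l+m$ and height $p$, and $C_2$ of circumference $m$ and height $q$. There are four horizontal segments: $s_k$ of length $k$, $s_l$ of length $l$, and $m_1,m_2$ of length $m$. Bottom of $C_1$, going right from $x=0$: $s_l,s_k,m_2$. Top of $C_1$, going right from $x=\alpha$ (mod $k+l+m$): $s_k,s_l,m_1$. Bottom of $C_2$ from $x=0$: $m_1$. Top of $C_2$ from $x=\beta$ (mod $m$): $m_2$. Glue top and bottom segments of the same name by translation. An $n$-square surface has cylinder diagram $B$ if it is isomorphic to a surface obtained this way. *)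

(* Defs.v *)
From mathcomp Require Import all_boot all_fingroup.

Set Implicit Arguments.
Unset Strict Implicit.
Unset Printing Implicit Defensive.

(* The right side of the square a is glued to the left side of right a, and its
   top side to the bottom side of top a. *)
Definition adjacent (S : finType) (right top : {perm S}) : rel S :=
  [rel a b | [|| b == right a, b == top a, a == right b | a == top b]].

Record square_surface := SquareSurface {
  squares :> finType;
  right_nbr : {perm squares};
  top_nbr : {perm squares};
  surface_connected :
    forall a b : squares, connect (adjacent right_nbr top_nbr) a b }.

Definition isomorphic (X Y : square_surface) : Prop :=
  exists f : X -> Y,
    [/\ bijective f,
        forall a, f (right_nbr X a) = right_nbr Y (f a)
      & forall a, f (top_nbr X a) = top_nbr Y (f a)].

(* The corner (a, (h, v)) of the square a is a right corner iff h = true, and a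
   top corner iff v = true. *)
Definition corner (X : square_surface) : finType := (X * (bool * bool))%type.

(* Identifications of corners made by gluing the right side of a square to the
   left side of its right neighbour, and its top side to the bottom side of its
   top neighbour. *)
Definition corner_glue (X : square_surface) : rel (corner X) :=
  [rel c d |
    let: (a, (h, v)) := c in let: (b, (h', v')) := d in
       [&& h, ~~ h', v == v' & b == right_nbr X a]
    || [&& v, ~~ v', h == h' & b == top_nbr X a]].

Definition same_vertex (X : square_surface) : rel (corner X) :=
  connect [rel c d | corner_glue c d || corner_glue d c].

Definition vertices (X : square_surface) : {set {set corner X}} :=
  equivalence_partition (@same_vertex X) [set: corner X].

(* Each corner contributes an angle pi/2, so the total angle at a vertex V is
   #|V| * pi/2: it is 2 pi when #|V| = 4, and 4 pi when #|V| = 8.  Points of the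
   surface that are not vertices have angle 2 pi. *)
Definition cone_points (X : square_surface) : {set {set corner X}} :=
  [set V in vertices X | #|V| != 4].

Definition in_H11 (X : square_surface) : Prop :=
  #|cone_points X| = 2 /\ (forall V, V \in cone_points X -> #|V| = 8).

(* The twists alpha and beta are unconstrained here: only their residues modulo
   the circumferences matter for the surface. *)
Record paramsB := ParamsB {
  hp : nat; hq : nat; lk : nat; ll : nat; lm : nat; alpha : nat; beta : nat;
  paramsB_gt0 : [&& 0 < hp, 0 < hq, 0 < lk, 0 < ll & 0 < lm] }.

Definition SigmaB (n : nat) (v : paramsB) : Prop :=
  [/\ alpha v < lk v + ll v + lm v,
      beta v < lm v
    & hp v * (lk v + ll v + lm v) + hq v * lm v = n].

Section SurfaceB.

Variable v : paramsB.
Local Notation p := (hp v).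
Local Notation q := (hq v).
Local Notation k := (lk v).
Local Notation l := (ll v).
Local Notation m := (lm v).

Fact hp_gt0 : 0 < p. Proof. by case/and5P: (paramsB_gt0 v). Qed.
Fact hq_gt0 : 0 < q. Proof. by case/and5P: (paramsB_gt0 v). Qed.

(* inl (i, x) is the square of C_1 in row i (from the bottom) and column x;
   inr (i, x) is the same for C_2. *)
Definition squaresB : finType := ('I_p * 'I_(k + l + m) + 'I_q * 'I_m)%type.

(* The unit edges of the four horizontal segments, numbered from the left. *)
Inductive edgeB :=
  | EdgeK of 'I_k | EdgeL of 'I_l | EdgeM1 of 'I_m | EdgeM2 of 'I_m.

Definition rightB (a : squaresB) : squaresB :=
  match a with
  | inl (i, x) => inl (i, ordS x)
  | inr (i, x) => inr (i, ordS x)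
  end.

(* iter a ord_pred x is x - a modulo the circumference: the position of the
   column x measured from a. *)
Definition edge_on_top1 (x : 'I_(k + l + m)) : edgeB :=
  match split (iter (alpha v) (@ord_pred _) x) with
  | inl y => match split y with inl z => EdgeK z | inr z => EdgeL z end
  | inr z => EdgeM1 z
  end.

Definition edge_on_top2 (x : 'I_m) : edgeB :=
  EdgeM2 (iter (beta v) (@ord_pred _) x).

Definition bottom_col1 (x : 'I_(l + k + m)) : squaresB :=
  inl (Ordinal hp_gt0, cast_ord (congr1 (addn^~ m) (addnC l k)) x).

Definition square_above (e : edgeB) : squaresB :=
  match e with
  | EdgeL z => bottom_col1 (lshift m (lshift k z))
  | EdgeK z => bottom_col1 (lshift m (rshift l z))
  | EdgeM2 z => bottom_col1 (rshift (l + k) z)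
  | EdgeM1 z => inr (Ordinal hq_gt0, z)
  end.

(* insub i.+1 is the next row, or None if i is the top row. *)
Definition topB (a : squaresB) : squaresB :=
  match a with
  | inl (i, x) =>
      if (insub i.+1 : option 'I_p) is Some i' then inl (i', x)
      else square_above (edge_on_top1 x)
  | inr (i, x) =>
      if (insub i.+1 : option 'I_q) is Some i' then inr (i', x)
      else square_above (edge_on_top2 x)
  end.

Fact rightB_inj : injective rightB.
Proof.
pose leftB (a : squaresB) : squaresB :=
  match a with
  | inl (i, x) => inl (i, ord_pred x)
  | inr (i, x) => inr (i, ord_pred x)
  end.
by apply: (@can_inj _ _ _ leftB) => -[[i x]|[i x]]; rewrite /leftB /rightB ordSK.
Qed.

Fact iter_ord_pred_inj n a : injective (iter a (@ord_pred n)).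
Proof. by elim: a => [|a IHa] x y //= /ord_pred_inj/IHa. Qed.

Fact edge_on_top1_inj : injective edge_on_top1.
Proof.
move=> x y eq_xy; apply: (@iter_ord_pred_inj _ (alpha v)); move: eq_xy.
rewrite /edge_on_top1; set x' := iter _ _ x; set y' := iter _ _ y.
rewrite -{2}(splitK x') -{2}(splitK y').
case: (split x') => a; case: (split y') => b.
- rewrite -{2}(splitK a) -{2}(splitK b).
  by case: (split a) => c; case: (split b) => d // [->].
- by case: (split a).
- by case: (split b).
- by case=> ->.
Qed.

Fact square_above_inj : injective square_above.
Proof.
pose pos (a : squaresB) : bool * nat :=
  match a with inl (_, x) => (true, x : nat) | inr (_, x) => (false, x : nat) end.
move=> e e' /(congr1 pos); case: e => x; case: e' => y //= [exy].
- by congr EdgeK; apply/val_inj/(@addnI l).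
- by have := ltn_ord y; rewrite -exy ltnNge leq_addr.
- by have := ltn_ord x; rewrite -(ltn_add2l l) exy -addnA ltnNge leq_add2l leq_addr.
- by have := ltn_ord x; rewrite exy ltnNge leq_addr.
- by congr EdgeL; apply/val_inj.
- by have := ltn_ord x; rewrite exy -addnA ltnNge leq_addr.
- by congr EdgeM1; apply/val_inj.
- by have := ltn_ord y; rewrite -(ltn_add2l l) -exy -addnA ltnNge leq_add2l leq_addr.
- by have := ltn_ord y; rewrite -exy -addnA ltnNge leq_addr.
- by congr EdgeM2; apply/val_inj/(@addnI (l + k)).
Qed.

Fact square_above_row e :
  match square_above e with inl (i, _) => i = 0 :> nat | inr (i, _) => i = 0 :> nat end.
Proof. by case: e. Qed.

Local Arguments square_above : simpl never.

Fact topB_inj : injective topB.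
Proof.
have abs_row1 (i j : 'I_p) x e :
  val j = i.+1 -> inl (j, x) = square_above e -> False.
  by move=> ji eqe; have := square_above_row e; rewrite -eqe ji.
have abs_row2 (i j : 'I_q) x e :
  val j = i.+1 -> inr (j, x) = square_above e -> False.
  by move=> ji eqe; have := square_above_row e; rewrite -eqe ji.
have last_row r (i j : 'I_r) : ~~ (i.+1 < r) -> ~~ (j.+1 < r) -> i = j.
  rewrite -!leqNgt => ri rj; apply/val_inj/eq_add_S/eqP.
  by rewrite eqn_leq (leq_trans (ltn_ord i) rj) (leq_trans (ltn_ord j) ri).
move=> [[i x]|[i x]] [[j y]|[j y]] /=.
all: case: insubP => [i' _ Di | Ni]; case: insubP => [j' _ Dj | Nj].
all: try by move/abs_row1 => /(_ _ Di).
all: try by move/abs_row2 => /(_ _ Di).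
all: try by move/esym/abs_row1 => /(_ _ Dj).
all: try by move/esym/abs_row2 => /(_ _ Dj).
all: try by [].
- case=> eij ->; congr (inl (_, _)); apply/val_inj/eq_add_S.
  by rewrite -Di -Dj eij.
- by move/square_above_inj/edge_on_top1_inj=> ->; rewrite (last_row _ i j Ni Nj).
- by move/square_above_inj; rewrite /edge_on_top1; case: split => // z; case: split.
- by move/square_above_inj; rewrite /edge_on_top1; case: split => // z; case: split.
- case=> eij ->; congr (inr (_, _)); apply/val_inj/eq_add_S.
  by rewrite -Di -Dj eij.
- move/square_above_inj; case=> /iter_ord_pred_inj ->.
  by rewrite (last_row _ i j Ni Nj).
Qed.

Definition right_permB : {perm squaresB} := perm rightB_inj.
Definition top_permB : {perm squaresB} := perm topB_inj.

Fact iter_ordS_val r n (x : 'I_r) : iter n (@ordS r) x = (x + n) %% r :> nat.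
Proof.
elim: n => [|n IHn] /=; first by rewrite addn0 modn_small.
by rewrite IHn -addn1 modnDml addn1 addnS.
Qed.

Fact connectedB a b : connect (adjacent right_permB top_permB) a b.
Proof.
set e := adjacent _ _.
have e_sym : symmetric e.
  move=> c d; rewrite /e /=.
  by apply/or4P/or4P=> -[] H; [exact: Or43 | exact: Or44 | exact: Or41
    | exact: Or42 | exact: Or43 | exact: Or44 | exact: Or41 | exact: Or42].
have c_sym : connect_sym e by exact: sym_connect_sym.
have eR c : connect e c (rightB c).
  by apply: connect1; apply/orP; left; rewrite eq_sym; apply/eqP; apply: permE.
have eT c : connect e c (topB c).
  by apply: connect1; apply/orP; right; apply/orP; left; rewrite eq_sym; apply/eqP; apply: permE.
pose o1 x : squaresB := inl (Ordinal hp_gt0, x).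
have row x y : connect e (o1 x) (o1 y).
  have R n z : connect e (o1 z) (o1 (iter n (@ordS _) z)).
    elim: n => [|n IHn]; first exact: connect0.
    exact: connect_trans IHn (eR _).
  wlog lexy : x y / x <= y.
    by move=> IH; case/orP: (leq_total x y) => /IH //; rewrite c_sym.
  suff -> : y = iter (y - x) (@ordS _) x by [].
  apply/val_inj/esym/(etrans (iter_ordS_val _ _)).
  by rewrite subnKC // modn_small.
have next1 (i : 'I_p) x : connect e (o1 x) (inl (i, x)).
  case: i => i; elim: i => [|i IHi] lti.
    by rewrite (_ : Ordinal lti = Ordinal hp_gt0) ?connect0 //; apply: val_inj.
  apply: connect_trans (IHi (ltnW lti)) _.
  suff -> : inl (Ordinal lti, x) = topB (inl (Ordinal (ltnW lti), x)) by [].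
  by rewrite /topB /= insubT.
have next2 (i : 'I_q) x : exists y, connect e (inr (i, x)) (o1 y).
  have [d] := ubnP (q - i); elim: d i => // d IHd i led.
  have := eT (inr (i, x)); rewrite /topB.
  case: insubP => [j _ Dj | _] Tij; last first.
    by eexists; apply: connect_trans Tij _; apply: connect0.
  have [|y Cy] := IHd j; last by exists y; apply: connect_trans Cy.
  by rewrite Dj subnS -ltnS prednK // subn_gt0.
suff to1 c : exists x, connect e c (o1 x).
  have [x ax] := to1 a; have [y bY] := to1 b.
  by apply: connect_trans ax (connect_trans (row x y) _); rewrite c_sym.
case: c => -[i x]; last exact: next2.
by exists x; rewrite c_sym.
Qed.

Definition surfaceB : square_surface := SquareSurface connectedB.

End SurfaceB.

Definition has_diagramB (X : square_surface) : Prop :=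
  exists v : paramsB, isomorphic X (surfaceB v).

Definition in_H11_B (n : nat) (X : square_surface) : Prop :=
  [/\ #|X| = n, in_H11 X & has_diagramB X].

(* Main.v *)
(* Let R and T be the right and top permutations of the squares.  Turning by
   2 pi around a vertex sends the square T (R a) having that vertex at its
   bottom left to R (T a), so the cycles of this commutator permutation of
   length c are the vertices of angle 2 pi c.  On the surface with diagram B it
   is the product of two disjoint transpositions (E G) (D F), where D, E, F, G
   start the segments s_l, s_k, m_2, m_1 on the bottom of C_1 and C_2; this gives
   the two cone points of angle 4 pi.

   An isomorphism preserves the commutator, hence permutes D, E, F, G; their
   positions in the rows force it to fix each of them.  The parameters can then
   be read off: the widths are lengths of R-orbits, the heights are the numbers
   of rows up to the next row containing a square moved by the commutator, l and
   k are the distances from D to E and from E to F, and the twists are given by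
   T^p (R^alpha D) = E and T^q (R^beta G) = F. *)

Require Import Defs.
From mathcomp Require Import all_boot all_fingroup zify.

Set Implicit Arguments.
Unset Strict Implicit.
Unset Printing Implicit Defensive.

(** * Vertices of a square surface and the commutator *)

Section ConePoints.

Variable X : square_surface.
Local Notation R := (right_nbr X).
Local Notation T := (top_nbr X).

(* The square having the vertex c at its bottom left, reached by going right
   first. *)
Definition base_square (c : corner X) : X :=
  let: (a, (h, v)) := c in
  if v then T (if h then R a else a) else if h then R a else a.

Lemma base_square_bij h v : bijective (fun a => base_square (a, (h, v))).
Proof.
by apply: injF_bij; case: h; case: v => a b //= => /perm_inj // /perm_inj.
Qed.

Lemma same_vertex_sym : symmetric (@same_vertex X).
Proof. by apply: sym_connect_sym => c d /=; rewrite orbC. Qed.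

Lemma same_vertex_right a v : same_vertex (a, (true, v)) (R a, (false, v)).
Proof. by apply: connect1; rewrite /= /corner_glue /= !eqxx. Qed.

Lemma same_vertex_top a h : same_vertex (a, (h, true)) (T a, (h, false)).
Proof. by apply: connect1; rewrite /= /corner_glue /= !eqxx !orbT. Qed.

Lemma same_vertex_base c : same_vertex c (base_square c, (false, false)).
Proof.
case: c => a [[] []] /=.
- exact: connect_trans (same_vertex_right _ _) (same_vertex_top _ _).
- exact: same_vertex_right.
- exact: same_vertex_top.
- exact: connect0.
Qed.

(** Both are the top right corner of [a], reached by going right first or up first. *)
Lemma same_vertex_comm a :
  same_vertex (T (R a), (false, false)) (R (T a), (false, false)).
Proof.
apply: (@connect_trans _ _ (a, (true, true))).
  by rewrite [connect _ _ _]same_vertex_sym; apply: same_vertex_base.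
exact: connect_trans (same_vertex_top _ _) (same_vertex_right _ _).
Qed.

(** For each of the four kinds of corner [base_square] permutes the squares, so every square is the
    base of exactly four corners. *)
Lemma card_base_square (P : pred X) :
  #|[set c | P (base_square c)]| = 4 * #|[set a | P a]|.
Proof.
pose g (c : corner X) := (base_square c, c.2).
have g_inj : injective g.
  move=> [a [h v]] [b [h' v']] [+ eh ev]; rewrite -eh -ev.
  by move/(bij_inj (base_square_bij h v)) => ->.
have -> : [set c | P (base_square c)] = g @^-1: setX [set a | P a] setT.
  by apply/setP => c; rewrite !inE andbT.
rewrite on_card_preimset ?cardsX ?cardsT ?card_prod ?card_bool 1?mulnC //.
exact/onW_bij/injF_bij.
Qed.

(** [base_square] sends the corners at one vertex into one orbit of the commutator. The orbits are
    [{a, b}], [{c, d}] and single squares, and four corners lie over each square: two vertices have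
    8 corners, the others 4. *)
Lemma in_H11_swap (a b c d : X) :
  uniq [:: a; b; c; d] ->
  (forall s, (tperm a b * tperm c d)%g (T (R s)) = R (T s)) -> in_H11 X.
Proof.
rewrite /= !inE !negb_or andbT => /and3P[/and3P[ab ac ad] /andP[bc bd] cd] comm.
have [[ca da] [cb db]] : (c != a /\ d != a) /\ (c != b /\ d != b).
  by rewrite ![_ == a]eq_sym ![_ == b]eq_sym.
set S := (_ * _)%g in comm.
(* [lab] chooses one square in each orbit of [S], so that [key] below will name the vertices. *)
pose lab s := if s == b then a else if s == d then c else s.
have Sa : S a = b by rewrite permM tpermL (tpermD cb db).
have Sc : S c = d by rewrite permM (tpermD ac bc) tpermL.
have labS s : lab (S s) = lab s.
  rewrite /S permM /lab; case: (tpermP a b) => [->|->|/eqP sa /eqP sb].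
  - by rewrite (tpermD cb db) eqxx (negPf ab) (negPf ad).
  - by rewrite (tpermD ca da) eqxx (negPf ab) (negPf ad).
  case: tpermP => [->|->|_ _ //].
  - by rewrite eqxx (negPf cb) (negPf db) (negPf cd).
  - by rewrite eqxx (negPf cb) (negPf db) (negPf cd).
pose key x := lab (base_square x).
have same_S s : same_vertex (s, (false, false)) (S s, (false, false)).
  pose s' := (R^-1 (T^-1 s))%g.
  have -> : s = T (R s') by rewrite !permKV.
  by rewrite comm same_vertex_comm.
have same_lab s : same_vertex (lab s, (false, false)) (s, (false, false)).
  rewrite /lab; case: eqP => [->|_]; first by rewrite -Sa.
  case: eqP => [->|_]; first by rewrite -Sc.
  exact: connect0.
have same_key x : same_vertex x (key x, (false, false)).
  apply: connect_trans (same_vertex_base x) _.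
  by rewrite [connect _ _ _]same_vertex_sym; apply: same_lab.
have key_glue x y : corner_glue x y -> key x = key y.
  case: x y => [s [h v]] [t [h' v']] /= /orP[] /and4P[].
    by move=> -> /negPf-> /eqP-> /eqP->.
  move=> -> /negPf-> /eqP-> /eqP->; rewrite /key /=.
  (* Only a top gluing of right corners changes the base square, from [T (R s)] to [R (T s)]; that
     is one application of [S]. *)
  by case: h'; rewrite -?comm ?labS.
have sameE x y : same_vertex x y = (key x == key y).
  apply/idP/eqP => [|eqk].
    case/connectP=> s; elim: s x => [|z s IHs] x /=; first by move=> _ ->.
    case/andP=> /orP xz zs ys; rewrite -(IHs z) //.
    by case: xz => /key_glue.
  apply: connect_trans (same_key x) _; rewrite eqk.
  by rewrite [connect _ _ _]same_vertex_sym; apply: same_key.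
pose K s : {set corner X} := [set x | key x == s].
have cardK s : #|K s| = 4 * #|[set t | lab t == s]|.
  exact: (card_base_square (fun t => lab t == s)).
have K_cell s : lab s = s -> (s, (false, false)) \in K s.
  by rewrite inE /key /= => ->.
have labK s : lab (lab s) = lab s.
  rewrite /lab; case: (eqVneq s b) => [_|sb]; first by rewrite (negPf ab) (negPf ad).
  case: (eqVneq s d) => [_|sd]; last by rewrite (negPf sb) (negPf sd).
  by rewrite (negPf cb) (negPf cd).
have verticesE V : (V \in vertices X) = [exists s, (lab s == s) && (V == K s)].
  apply/imsetP/existsP => [[x _ ->]|[s /andP[/eqP ls /eqP->]]].
    exists (key x); rewrite labK eqxx; apply/eqP/setP=> y.
    by rewrite !inE /= sameE eq_sym.
  exists (s, (false, false)) => //; apply/setP => y.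
  by rewrite !inE /= sameE {2}/key /= ls eq_sym.
have la : lab a = a by rewrite /lab (negPf ab) (negPf ad).
have lc : lab c = c by rewrite /lab (negPf cb) (negPf cd).
have Ka : #|K a| = 8.
  rewrite cardK (_ : [set _ | _] = [set a; b]) ?cards2 ?ab //.
  apply/setP=> t; rewrite !inE /lab.
  case: (eqVneq t b) => [->|tb]; first by rewrite eqxx orbT.
  case: (eqVneq t d) => [->|//]; last by rewrite orbF.
  by rewrite (negPf ca) (negPf da).
have Kc : #|K c| = 8.
  rewrite cardK (_ : [set _ | _] = [set c; d]) ?cards2 ?cd //.
  apply/setP=> t; rewrite !inE /lab.
  case: (eqVneq t b) => [->|tb]; first by rewrite (negPf ac) (negPf bc) (negPf bd).
  by case: (eqVneq t d) => [->|td]; rewrite ?eqxx ?orbT ?orbF.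
have Ks s : lab s = s -> s != a -> s != c -> #|K s| = 4.
  move=> ls sa sc; rewrite cardK (_ : [set _ | _] = [set s]) ?cards1 //.
  apply/setP=> t; rewrite !inE; apply/eqP/eqP => [|-> //].
  rewrite /lab; case: ifP => [_ as_|_]; first by rewrite as_ eqxx in sa.
  by case: ifP => // _ cs; rewrite cs eqxx in sc.
have Kac : K a != K c.
  apply/eqP => /setP/(_ (a, (false, false))).
  by rewrite K_cell // inE /key /= la (negPf ac).
suff cpE : cone_points X = [set K a; K c].
  split; first by rewrite cpE cards2 Kac.
  by move=> V; rewrite cpE !inE => /orP[]/eqP->.
apply/setP => V; rewrite in_set2 inE verticesE.
apply/andP/orP => [[/existsP[s /andP[/eqP ls /eqP->]] V4]|[]/eqP->].
- case: (eqVneq s a) V4 => [->|sa]; first by left.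
  by case: (eqVneq s c) => [->|sc]; [right | rewrite Ks].
- by rewrite Ka; split=> //; apply/existsP; exists a; rewrite la !eqxx.
- by rewrite Kc; split=> //; apply/existsP; exists c; rewrite lc !eqxx.
Qed.

End ConePoints.

Arguments rightB : simpl never.
Arguments topB : simpl never.

(** * Coordinates on the surface with diagram B, and its commutator *)

Section Cells.

Variable v : paramsB.
Local Notation p := (hp v).
Local Notation q := (hq v).
Local Notation k := (lk v).
Local Notation l := (ll v).
Local Notation m := (lm v).

Definition height (b : bool) := if b then p else q.
Definition width (b : bool) := if b then k + l + m else m.

Lemma params_gt0 : [/\ 0 < p, 0 < q, 0 < k, 0 < l & 0 < m].
Proof. exact/and5P/(paramsB_gt0 v). Qed.

Lemma lm_gt0 : 0 < m. Proof. by case: params_gt0. Qed.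

Lemma circumference_gt0 : 0 < k + l + m.
Proof. by rewrite addn_gt0 lm_gt0 orbT. Qed.

Lemma width_gt0 b : 0 < width b.
Proof. by case: b; rewrite ?circumference_gt0 ?lm_gt0. Qed.

Lemma height_gt0 b : 0 < height b.
Proof. by case: b; rewrite ?hp_gt0 ?hq_gt0. Qed.

(* The square of C_1 (b = true) or C_2 (b = false) in row i and column x, both
   taken modulo the size of the cylinder. *)
Definition cell (b : bool) (i x : nat) : squaresB v :=
  if b then inl (Ordinal (ltn_pmod i (hp_gt0 v)),
                 Ordinal (ltn_pmod x circumference_gt0))
  else inr (Ordinal (ltn_pmod i (hq_gt0 v)), Ordinal (ltn_pmod x lm_gt0)).

Lemma cellP a :
  exists b i x, [/\ i < height b, x < width b & a = cell b i x].
Proof.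
case: a => -[i x]; [exists true | exists false]; exists i, x; split;
  rewrite ?ltn_ord //; [congr (inl (_, _)) | congr (inr (_, _))].
all: by apply: val_inj; rewrite /= modn_small ?ltn_ord.
Qed.

Lemma cell_eq b i x b' i' x' :
  (cell b i x == cell b' i' x') =
  [&& b == b', i == i' %[mod height b] & x == x' %[mod width b]].
Proof. by case: b; case: b'. Qed.

Lemma cell_modr b i x y : x = y %[mod width b] -> cell b i x = cell b i y.
Proof. by move=> exy; apply/eqP; rewrite cell_eq !eqxx exy /=. Qed.

Lemma rightB_cell b i x : rightB (cell b i x) = cell b i x.+1.
Proof.
case: b; [congr (inl (_, _)) | congr (inr (_, _))].
all: by apply: val_inj; rewrite /= -addn1 modnDml addn1.
Qed.

Lemma topB_cell b i x : i.+1 < height b -> topB (cell b i x) = cell b i.+1 x.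
Proof.
(* The row stored in [cell] is reduced modulo the height, so [insub] needs the bound in that
   form. *)
rewrite /topB; case: b => /= lti; have lti' := lti;
  rewrite -(modn_small (ltnW lti)) in lti'.
  rewrite (insubT (fun j => j < p) lti'); apply: (congr1 (fun j => inl (j, _))).
  apply: val_inj.
  by rewrite /= (modn_small (ltnW lti)) modn_small.
rewrite (insubT (fun j => j < q) lti'); apply: (congr1 (fun j => inr (j, _))).
apply: val_inj.
by rewrite /= (modn_small (ltnW lti)) modn_small.
Qed.

(** [ord_pred] undoes [ordS]. With [a] a twist, this evaluates the position used by [edge_on_top1]
    and [edge_on_top2]. *)
Lemma iter_ord_pred_cell r (r_gt0 : 0 < r) a y :
  y < r -> iter a (@ord_pred r) (Ordinal (ltn_pmod (a + y) r_gt0)) = y :> nat.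
Proof.
move=> ltyr; pose z := Ordinal ltyr.
have -> : Ordinal (ltn_pmod (a + y) r_gt0) = iter a (@ordS r) z.
  by apply: val_inj; rewrite /= iter_ordS_val addnC.
by elim: a => [|a IHa] //; rewrite iterSr [iter a.+1 (@ordS r) z]iterS ordSK.
Qed.

(** Here [y] counts columns from the left end of [s_k] on the top of C_1. The cases are [s_k], [s_l]
    and [m_1], whose bottom copies start in columns [l] and 0 of C_1 and column 0 of C_2. *)
Lemma topB_C1 y : y < k + l + m ->
  topB (cell true p.-1 (alpha v + y)) =
    if y < k then cell true 0 (l + y)
    else if y < k + l then cell true 0 (y - k)
    else cell false 0 (y - (k + l)).
Proof.
move=> lty; rewrite /topB /=.
case: insubP => [j /= |_]; first by rewrite modn_small ?prednK ?hp_gt0 ?ltnn.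
rewrite /edge_on_top1.
have := iter_ord_pred_cell circumference_gt0 (alpha v) lty.
move: (iter _ _ _) => z Dz; case: splitP => [y1|y2] Dy; last first.
  rewrite /square_above ifN ?ifN; try lia.
  congr (inr (_, _)); apply: val_inj; rewrite /= ?mod0n ?modn_small //; lia.
case: (splitP y1) => [y3|y3] Dy3; have lt3 := ltn_ord y3.
  rewrite ifT; last by lia.
  congr (inl (_, _)); apply: val_inj; rewrite /= ?mod0n ?modn_small //; lia.
rewrite ifN ?ifT; try lia.
by congr (inl (_, _)); apply: val_inj; rewrite /= ?mod0n ?modn_small //; lia.
Qed.

Lemma topB_C2 y : y < m ->
  topB (cell false q.-1 (beta v + y)) = cell true 0 (l + k + y).
Proof.
move=> lty; rewrite /topB /=.
case: insubP => [j /= |_]; first by rewrite modn_small ?prednK ?hq_gt0 ?ltnn.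
have /= Dz := iter_ord_pred_cell lm_gt0 (beta v) lty.
congr (inl (_, _)); apply: val_inj => /=.
  by rewrite mod0n.
rewrite Dz modn_small //; lia.
Qed.

Lemma cell_shift b i x a : x < width b ->
  exists2 y, y < width b & cell b i x = cell b i (a + y).
Proof.
move=> ltx; exists ((x + (width b - a %% width b)) %% width b).
  by rewrite ltn_mod width_gt0.
apply: cell_modr; rewrite modnDmr -modnDml addnCA subnKC ?modnDr //.
by rewrite ltnW // ltn_mod width_gt0.
Qed.

Arguments cell : simpl never.

(* D, E, F and G are the squares whose bottom left corner is the left endpoint
   of s_l, s_k, m_2 and m_1 respectively. *)
Definition cellD := cell true 0 0.
Definition cellE := cell true 0 l.
Definition cellF := cell true 0 (l + k).
Definition cellG := cell false 0 0.

Definition swapB : {perm squaresB v} := tperm cellE cellG * tperm cellD cellF.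

Lemma uniq_DEFG : uniq [:: cellE; cellG; cellD; cellF].
Proof.
have [p0 q0 k0 l0 m0] := params_gt0.
by rewrite /= !inE !cell_eq /= !modn_small //; lia.
Qed.

Lemma swapB_values :
  [/\ swapB cellD = cellF, swapB cellE = cellG,
      swapB cellF = cellD & swapB cellG = cellE].
Proof.
have := uniq_DEFG; rewrite /= !inE !negb_or.
case/and3P=> /and3P[EG ED EF] DF _.
have [GD GF] : cellG != cellD /\ cellG != cellF by [].
rewrite !permM; split.
- by rewrite (tpermD ED GD) tpermL.
- by rewrite tpermL tpermD // eq_sym.
- by rewrite (tpermD EF GF) tpermR.
- by rewrite tpermR tpermD // eq_sym.
Qed.

Lemma swapB_id a : a \notin [:: cellE; cellG; cellD; cellF] -> swapB a = a.
Proof.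
rewrite !inE !negb_or => /and4P[aE aG aD aF].
by rewrite permM [tperm cellE _ a]tpermD ?tpermD 1?eq_sym.
Qed.

Lemma swapB_cell b i x : i < height b -> x < width b ->
  (swapB (cell b i x) == cell b i x) =
    ~~ ((i == 0) && (x \in if b then [:: 0; l; l + k] else [:: 0])).
Proof.
move=> lti ltx; have [p0 q0 k0 l0 m0] := params_gt0.
have [] := boolP (cell b i x \in [:: cellE; cellG; cellD; cellF]); last first.
  move=> nin; rewrite (swapB_id nin) eqxx; move: nin.
  rewrite !inE !cell_eq; case: b lti ltx => /= lti ltx; rewrite !inE !modn_small //; lia.
have [SD SE SF SG] := swapB_values.
rewrite !inE => /or4P[] /eqP Da; rewrite Da ?SD ?SE ?SF ?SG cell_eq;
  move/eqP: Da; rewrite cell_eq;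
  case: b lti ltx => //= lti ltx; rewrite !inE !modn_small //; lia.
Qed.

(** The two paths differ only at the right end of a top segment, where they reach the start of the
    next segment in the top order and in the bottom order. After [s_k], [s_l], [m_1], [m_2] these
    starts are D and F, G and E, E and G, F and D. *)
Lemma swapB_comm a : swapB (topB (rightB a)) = rightB (topB a).
Proof.
have [SD SE SF SG] := swapB_values.
have [p0 q0 k0 l0 m0] := params_gt0.
have fixC b i x : i < height b -> x < width b ->
    ~~ ((i == 0) && (x \in if b then [:: 0; l; l + k] else [:: 0])) ->
    swapB (cell b i x) = cell b i x.
  by move=> lti ltx ns; apply/eqP; rewrite swapB_cell.
have [b [i [x [lti ltx ->]]]] := cellP a.
have [ltSi|] := ltnP i.+1 (height b).
  rewrite rightB_cell !topB_cell // rightB_cell.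
  rewrite (@cell_modr b _ x.+1 (x.+1 %% width b)) ?modn_mod //.
  by rewrite fixC // ltn_mod width_gt0.
move=> gei; have {lti gei}-> : i = (height b).-1 by lia.
case: b ltx => /= ltx.
  have [y /= lty ->] := @cell_shift true p.-1 _ (alpha v) ltx.
  rewrite rightB_cell -addnS.
  have [Sy|Sy] := ltnP y.+1 (k + l + m); last first.
    have Dy : y.+1 = width true by rewrite /=; lia.
    have -> : cell true p.-1 (alpha v + y.+1) = cell true p.-1 (alpha v + 0).
      by apply: cell_modr; rewrite Dy addn0 modnDr.
    rewrite !topB_C1 //; last lia.
    rewrite ifT // addn0 SE ifN ?ifN ?rightB_cell; try lia.
    apply: cell_modr; rewrite /= mod0n -{1}(modnn m); congr (_ %% _); lia.
  rewrite !topB_C1 //.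
  have [yk|yk] := ltnP y k.
    have [Syk|Syk] := ltnP y.+1 k.
      by rewrite fixC /= ?inE ?rightB_cell ?addnS //; lia.
    rewrite ifT ?rightB_cell; last lia.
    have -> : y.+1 - k = 0 by lia.
    rewrite SD; congr (cell _ _ _); lia.
  rewrite ifN; last lia.
  have [yl|yl] := ltnP y (k + l).
    have [Syl|Syl] := ltnP y.+1 (k + l).
      by rewrite fixC /= ?inE ?rightB_cell ?subSn //; lia.
    have -> : y.+1 - (k + l) = 0 by lia.
    by rewrite SG rightB_cell /cellE; congr (cell _ _ _); lia.
  rewrite ifN; last lia.
  by rewrite fixC /= ?inE ?rightB_cell ?subSn //; lia.
have [y /= lty ->] := @cell_shift false q.-1 _ (beta v) ltx.
rewrite rightB_cell -addnS [topB (cell _ _ (_ + y))]topB_C2 // rightB_cell.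
have [Sy|Sy] := ltnP y.+1 m.
  by rewrite topB_C2 // fixC /= ?inE ?addnS //; lia.
have Dy : y.+1 = width false by rewrite /=; lia.
have -> : cell false q.-1 (beta v + y.+1) = cell false q.-1 (beta v + 0).
  by apply: cell_modr; rewrite Dy addn0 modnDr.
rewrite topB_C2 // addn0 SF.
apply: cell_modr; rewrite /= mod0n -(modnn (k + l + m)); congr (_ %% _); lia.
Qed.

(** * Walking along rows and climbing through cylinders *)

Lemma iter_rightB_cell b i x n :
  iter n (@rightB v) (cell b i x) = cell b i (x + n).
Proof.
by elim: n => [|n IHn]; rewrite ?addn0 // iterS IHn rightB_cell addnS.
Qed.

Lemma iter_topB_cell b x n :
  n < height b -> iter n (@topB v) (cell b 0 x) = cell b n x.
Proof. by elim: n => // n IHn ltn; rewrite iterS IHn ?topB_cell // ltnW. Qed.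

Lemma topB_top_row b x :
  exists b' x', topB (cell b (height b).-1 x) = cell b' 0 x'.
Proof.
rewrite (@cell_modr _ _ x (x %% width b)) ?modn_mod //.
have := ltn_pmod x (width_gt0 b).
move: (x %% _) => {}x; case: b => /= ltx.
  have [y /= lty ->] := @cell_shift true p.-1 _ (alpha v) ltx.
  by rewrite topB_C1 //; do 2?case: ifP => _; do 2!eexists.
have [y /= lty ->] := @cell_shift false q.-1 _ (beta v) ltx.
by rewrite topB_C2 //; do 2!eexists.
Qed.

Lemma iter_height_topB b x :
  exists b' x', iter (height b) (@topB v) (cell b 0 x) = cell b' 0 x'.
Proof.
have [b' [x' e]] := topB_top_row b x; exists b', x'.
rewrite -(prednK (height_gt0 b)) iterS iter_topB_cell //.
by rewrite prednK ?height_gt0.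
Qed.

Lemma iter_topB_alpha : iter p (@topB v) (cell true 0 (alpha v)) = cellE.
Proof.
have [p0 q0 k0 l0 m0] := params_gt0.
rewrite -[p](prednK p0) iterS iter_topB_cell ?prednK //.
by rewrite -[alpha v]addn0 topB_C1 ?k0 ?addn0 //; lia.
Qed.

Lemma iter_topB_beta : iter q (@topB v) (cell false 0 (beta v)) = cellF.
Proof.
have [p0 q0 k0 l0 m0] := params_gt0.
rewrite -[q](prednK q0) iterS iter_topB_cell ?prednK //.
by rewrite -[beta v]addn0 topB_C2 ?addn0.
Qed.

Lemma swapB_moved a :
  (swapB a != a) = (a \in [:: cellE; cellG; cellD; cellF]).
Proof.
have [|nin] := boolP (a \in _); last by rewrite (swapB_id nin) eqxx.
have [p0 q0 k0 l0 m0] := params_gt0.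
have [SD SE SF SG] := swapB_values.
rewrite !inE => /or4P[] /eqP->; rewrite ?SD ?SE ?SF ?SG cell_eq //=.
all: rewrite !modn_small //; lia.
Qed.

(** This describes the bottom rows of the cylinders by [rightB] and the commutator alone, hence in a
    form that isomorphisms preserve. *)
Definition singular_row (a : squaresB v) :=
  exists n, swapB (iter n (@rightB v) a) != iter n (@rightB v) a.

Lemma singular_row_cell b i x :
  i < height b -> singular_row (cell b i x) <-> i = 0.
Proof.
move=> lti; split=> [[n]|->].
  rewrite iter_rightB_cell swapB_moved !inE !cell_eq => /or4P[] /and3P[_ + _];
    by rewrite mod0n modn_small // => /eqP.
(* This many steps to the right lead around to column 0, that is to D or G. *)
exists (width b - x %% width b).
rewrite iter_rightB_cell (@cell_modr _ _ _ 0).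
  by rewrite swapB_moved; case: b {lti}; rewrite !inE eqxx ?orbT.
by rewrite -modnDml subnKC ?modnn ?mod0n // ltnW // ltn_mod width_gt0.
Qed.

End Cells.

Arguments cell : simpl never.

Lemma iter_inj T (g : T -> T) n : injective g -> injective (iter n g).
Proof. by move=> g_inj; elim: n => //= n IHn x y /g_inj/IHn. Qed.

Lemma paramsB_eq v v' :
  hp v = hp v' -> hq v = hq v' -> lk v = lk v' -> ll v = ll v' ->
  lm v = lm v' -> alpha v = alpha v' -> beta v = beta v' -> v = v'.
Proof.
case: v => p q k l m a b g; case: v' => p' q' k' l' m' a' b' g' /=.
move=> ep eq ek el em ea eb; subst; congr ParamsB; exact: bool_irrelevance.
Qed.

(** * Recovering the parameters from an isomorphism *)

Section Uniqueness.

Variables (v v' : paramsB) (f : squaresB v -> squaresB v').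
Hypothesis f_inj : injective f.
Hypothesis f_right : forall a, f (rightB a) = rightB (f a).
Hypothesis f_top : forall a, f (topB a) = topB (f a).

Lemma iso_iter_right n a : f (iter n (@rightB v) a) = iter n (@rightB v') (f a).
Proof. by elim: n => //= n IHn; rewrite f_right IHn. Qed.

Lemma iso_iter_top n a : f (iter n (@topB v) a) = iter n (@topB v') (f a).
Proof. by elim: n => //= n IHn; rewrite f_top IHn. Qed.

Lemma iso_swap a : f (swapB v a) = swapB v' (f a).
Proof.
(* [swapB_comm] evaluates the commutator only on squares written as [topB (rightB b)]. *)
pose b := ((right_permB v)^-1 ((top_permB v)^-1 a))%g.
have -> : a = topB (rightB b).
  have /esym := permKV (top_permB v) a; rewrite permE.
  by rewrite -{1}(permKV (right_permB v) ((top_permB v)^-1%g a)) permE.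
by rewrite swapB_comm f_right f_top f_top f_right swapB_comm.
Qed.

Lemma iso_moved a : (swapB v' (f a) == f a) = (swapB v a == a).
Proof. by rewrite -iso_swap (inj_eq f_inj). Qed.

(** The width is the length of a [rightB]-orbit. Each width is a period of the other orbit, so they
    divide each other. *)
Lemma iso_cell_width b i x b' i' x' :
  f (cell v b i x) = cell v' b' i' x' -> width v b = width v' b'.
Proof.
move=> fa; apply/eqP; rewrite eqn_dvd; apply/andP; split.
  have := iso_iter_right (width v' b') (cell v b i x).
  rewrite fa !iter_rightB_cell (@cell_modr v' _ _ (x' + _) x') ?modnDr // -fa.
  by move/f_inj/eqP; rewrite cell_eq -{2}[x]addn0 eqn_modDl mod0n => /and3P[].
have := iso_iter_right (width v b) (cell v b i x).
rewrite fa !iter_rightB_cell (@cell_modr v _ _ (x + _) x) ?modnDr // fa.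
by move/esym/eqP; rewrite cell_eq -{2}[x']addn0 eqn_modDl mod0n => /and3P[].
Qed.

Lemma iso_singular_row a : singular_row (f a) <-> singular_row a.
Proof. by split=> -[n nS]; exists n; move: nS; rewrite -iso_iter_right iso_moved. Qed.

(** After climbing the smaller height, one surface is back in a singular row while the other is
    strictly inside a cylinder. *)
Lemma iso_cell_height b x b' x' :
  f (cell v b 0 x) = cell v' b' 0 x' -> height v b = height v' b'.
Proof.
move=> fa; case: (ltngtP (height v b) (height v' b')) => // lt_h.
  have [b2 [x2 e2]] := iter_height_topB v b x.
  have := iso_iter_top (height v b) (cell v b 0 x).
  rewrite fa (@iter_topB_cell v') // e2 => e.
  have /iso_singular_row : singular_row (cell v b2 0 x2).
    by apply/singular_row_cell => //; apply: height_gt0.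
  rewrite e singular_row_cell // => h0.
  by have := height_gt0 v b; rewrite h0.
have [b2 [x2 e2]] := iter_height_topB v' b' x'.
have := iso_iter_top (height v' b') (cell v b 0 x).
rewrite fa (@iter_topB_cell v) // e2 => e.
have : singular_row (cell v' b2 0 x2).
  by apply/singular_row_cell => //; apply: height_gt0.
rewrite -e iso_singular_row singular_row_cell // => h0.
by have := height_gt0 v' b'; rewrite h0.
Qed.

(* G is the only square of its row moved by the commutator, while D, E and F
   share theirs. *)
Lemma iso_cellG : f (cellG v) = cellG v'.
Proof.
have : swapB v' (f (cellG v)) != f (cellG v).
  by rewrite iso_moved swapB_moved !inE eqxx orbT.
have rowG n : swapB v' (iter n (@rightB v') (f (cellG v)))
    != iter n (@rightB v') (f (cellG v)) ->
    iter n (@rightB v') (f (cellG v)) = f (cellG v).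
  rewrite -iso_iter_right iso_moved iter_rightB_cell swapB_moved !inE.
  rewrite !cell_eq => /or4P[] /and3P[] // _ _ n0.
  by congr f; apply/eqP; rewrite cell_eq !eqxx n0.
(* Otherwise the image of G lies in the bottom row of C_1, and by [rowG] both D and E of [v'] would
   coincide with it. *)
rewrite swapB_moved !inE orbCA => /orP[/eqP-> //|in1].
have [x fG] : exists x, f (cellG v) = cell v' true 0 x.
  by case/or3P: in1 => /eqP->; eexists.
have toC y : y < width v' true ->
    cell v' true 0 y \in [:: cellE v'; cellG v'; cellD v'; cellF v'] ->
    cell v' true 0 y = f (cellG v).
  move=> lty; have [z _ ->] := cell_shift 0 x lty.
  by rewrite -iter_rightB_cell -fG -swapB_moved => /rowG.
have [p0 q0 k0 l0 m0] := params_gt0 v'.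
have := uniq_DEFG v'; rewrite /= !inE !negb_or => /andP[/and3P[_ ED _] _].
have E_eq : cellE v' = f (cellG v).
  by apply: toC; [rewrite /=; lia | rewrite !inE eqxx].
have D_eq : cellD v' = f (cellG v).
  by apply: toC; [rewrite /=; lia | rewrite !inE eqxx !orbT].
by rewrite E_eq D_eq eqxx in ED.
Qed.

Lemma iso_cellE : f (cellE v) = cellE v'.
Proof.
have [_ _ _ <-] := swapB_values v; have [_ _ _ <-] := swapB_values v'.
by rewrite iso_swap iso_cellG.
Qed.

Lemma iso_lm : lm v = lm v'.
Proof. exact: iso_cell_width iso_cellG. Qed.

Lemma iso_circumference : lk v + ll v + lm v = lk v' + ll v' + lm v'.
Proof. exact: iso_cell_width iso_cellE. Qed.

(* Going right from E one meets F before D, so these two are not exchanged. *)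
Lemma iso_cellD : f (cellD v) = cellD v'.
Proof.
have [p0 q0 k0 l0 m0] := params_gt0 v.
have [p0' q0' k0' l0' m0'] := params_gt0 v'.
have [SD SE SF SG] := swapB_values v; have [SD' SE' SF' SG'] := swapB_values v'.
have : swapB v' (f (cellD v)) != f (cellD v).
  by rewrite iso_moved swapB_moved !inE eqxx !orbT.
rewrite swapB_moved !inE -iso_cellE -iso_cellG !(inj_eq f_inj).
have := uniq_DEFG v; rewrite /= !inE !negb_or => /andP[/and3P[_ ED _] _].
rewrite eq_sym (negPf ED) /= => /orP[/eqP //|/eqP fD].
(* Suppose [f] exchanges D and F. From E one meets F after [lk v] steps and D after [lk v + lm v];
   in [v'] these steps would lead to D and F. *)
have fF : f (cellF v) = cellD v' by rewrite -SD iso_swap fD SF'.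
have := iso_circumference; have := iso_lm.
have := iso_iter_right (lk v) (cellE v).
rewrite iso_cellE !iter_rightB_cell -/(cellF v) fF => /eqP.
rewrite cell_eq /= !mod0n.
have := iso_iter_right (lk v + lm v) (cellE v).
rewrite iso_cellE !iter_rightB_cell.
have -> : cell v true 0 (ll v + (lk v + lm v)) = cellD v.
  by apply: cell_modr; rewrite /= mod0n addnCA addnA modnn.
rewrite fD => /eqP; rewrite cell_eq /= => /andP[_].
rewrite (modn_small (_ : ll v' + lk v' < _)); last lia.
move=> e1 e2 em en.
(* The left side is a positive multiple of the circumference and less than twice it. *)
have lkE : ll v' + lk v = lk v' + ll v' + lm v'.
  have /dvdnP[j Dj] : lk v' + ll v' + lm v' %| ll v' + lk v by rewrite /dvdn; lia.
  by case: j Dj => [|[|j]] Dj; nia.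
(* Now [e1] amounts to [lm v = ll v' + lk v'], whereas [lkE] gives [ll v' = ll v + lm v], which is
   larger. *)
exfalso; move: e1; rewrite addnA lkE modnDl modn_small; lia.
Qed.

Lemma iso_cellF : f (cellF v) = cellF v'.
Proof.
have [<- _ _ _] := swapB_values v; have [<- _ _ _] := swapB_values v'.
by rewrite iso_swap iso_cellD.
Qed.

Lemma params_unique :
  alpha v < lk v + ll v + lm v -> beta v < lm v ->
  alpha v' < lk v' + ll v' + lm v' -> beta v' < lm v' -> v = v'.
Proof.
have em := iso_lm; have en := iso_circumference.
have ep : hp v = hp v' := iso_cell_height iso_cellD.
have eq : hq v = hq v' := iso_cell_height iso_cellG.
have [p0 q0 k0 l0 m0] := params_gt0 v.
have [p0' q0' k0' l0' m0'] := params_gt0 v'.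
have el : ll v = ll v'.
  have := iso_iter_right (ll v) (cellD v).
  rewrite iso_cellD !iter_rightB_cell !add0n iso_cellE => /eqP.
  by rewrite cell_eq /= !modn_small; lia.
have ek : lk v = lk v' by lia.
move=> la lb la' lb'; apply: paramsB_eq => //.
  (* Columns [alpha v] and [alpha v'] of the bottom row of [v'] both reach E after [hp v] steps up,
     so injectivity of [topB] identifies them. *)
  have := iso_iter_top (hp v) (iter (alpha v) (@rightB v) (cellD v)).
  rewrite iso_iter_right iso_cellD !iter_rightB_cell !add0n iter_topB_alpha iso_cellE.
  rewrite -iter_topB_alpha ep => /(iter_inj (@topB_inj v'))/eqP.
  by rewrite cell_eq /= !modn_small; lia.
have := iso_iter_top (hq v) (iter (beta v) (@rightB v) (cellG v)).
rewrite iso_iter_right iso_cellG !iter_rightB_cell !add0n iter_topB_beta iso_cellF.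
rewrite -iter_topB_beta eq => /(iter_inj (@topB_inj v'))/eqP.
by rewrite cell_eq /= !modn_small; lia.
Qed.

End Uniqueness.

(** * Cone points of diagram B, reduction of the twists, and conclusion *)

Lemma in_H11_surfaceB v : in_H11 (surfaceB v).
Proof.
apply: (@in_H11_swap (surfaceB v) _ _ _ _ (uniq_DEFG v)) => a.
by rewrite [right_nbr (surfaceB v) a]permE [top_nbr (surfaceB v) a]permE
  [top_nbr _ _]permE [right_nbr _ _]permE; apply: swapB_comm.
Qed.

Lemma card_surfaceB v :
  #|surfaceB v| = hp v * (lk v + ll v + lm v) + hq v * lm v.
Proof. by rewrite card_sum !card_prod !card_ord. Qed.

Lemma isomorphic_refl X : isomorphic X X.
Proof. by exists id; split=> //; exists id. Qed.

Lemma isomorphic_sym X Y : isomorphic X Y -> isomorphic Y X.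
Proof.
case=> f [[g fK gK] fR fT]; exists g; split; first by exists f.
- by move=> a; apply: (can_inj fK); rewrite fR !gK.
- by move=> a; apply: (can_inj fK); rewrite fT !gK.
Qed.

Lemma isomorphic_trans X Y Z :
  isomorphic X Y -> isomorphic Y Z -> isomorphic X Z.
Proof.
case=> f [f_bij fR fT] [g [g_bij gR gT]]; exists (g \o f); split.
- exact: bij_comp.
- by move=> a; rewrite /= fR gR.
- by move=> a; rewrite /= fT gT.
Qed.

Lemma reduce_twists v :
  exists w, SigmaB #|surfaceB v| w /\ isomorphic (surfaceB v) (surfaceB w).
Proof.
case: v => p q k l m a b g; set v := ParamsB _ _ g.
pose w := @ParamsB p q k l m (a %% (k + l + m)) (b %% m) g.
exists w; split.
  split; [| |by rewrite card_surfaceB].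
  - exact/ltn_pmod/(circumference_gt0 v).
  - exact/ltn_pmod/(lm_gt0 v).
(* [v] and [w] differ only in their twists, so their squares form the same type and [f] is the
   identity. *)
pose f (s : squaresB v) : squaresB w := s.
have fcell c i x : f (cell v c i x) = cell w c i x.
  by case: c; [congr (inl (_, _)) | congr (inr (_, _))]; apply: val_inj.
exists f; split; first by exists id.
  move=> s; rewrite [right_nbr _ s]permE [right_nbr _ _]permE.
  have [c [i [x [_ _ ->]]]] := cellP s.
  by rewrite fcell !rightB_cell fcell.
move=> s; rewrite [top_nbr _ s]permE [top_nbr _ _]permE.
have [c [i [x [lti ltx ->]]]] := cellP s.
have [ltSi|] := ltnP i.+1 (height v c).
  by rewrite fcell !topB_cell.
move=> gei; have {lti gei}-> : i = (height v c).-1 by lia.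
case: c ltx => /= ltx.
  have [y /= lty ->] := @cell_shift v true p.-1 _ a ltx.
  have -> : f (cell v true p.-1 (a + y)) = cell w true (hp w).-1 (alpha w + y).
    by rewrite fcell; apply: cell_modr; rewrite /= modnDml.
  by rewrite (@topB_C1 v) // topB_C1 //; do 2?case: ifP => _.
have [y /= lty ->] := @cell_shift v false q.-1 _ b ltx.
have -> : f (cell v false q.-1 (b + y)) = cell w false (hq w).-1 (beta w + y).
  by rewrite fcell; apply: cell_modr; rewrite /= modnDml.
by rewrite (@topB_C2 v) // topB_C2.
Qed.

Theorem proposition3p5 (n : nat) (n_gt0 : 0 < n) :
  (forall v : paramsB, SigmaB n v -> in_H11_B n (surfaceB v)) /\
  (forall X : square_surface, in_H11_B n X ->
     exists! v : paramsB, SigmaB n v /\ isomorphic X (surfaceB v)).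
Proof.
split=> [v [_ _ Dn] | X [cardX _ [v0 isoX0]]].
  split; [by rewrite card_surfaceB | exact: in_H11_surfaceB |].
  exists v; exact: isomorphic_refl.
have [v [Sv iso0v]] := reduce_twists v0.
have cardv0 : #|surfaceB v0| = n.
  by case: isoX0 => f [f_bij _ _]; rewrite -(bij_eq_card f_bij).
rewrite cardv0 in Sv; have isoXv := isomorphic_trans isoX0 iso0v.
exists v; split=> // w [Sw isoXw].
have [f [f_bij fR fT]] := isomorphic_trans (isomorphic_sym isoXv) isoXw.
case: Sv Sw => [av bv _] [aw bw _].
apply: (@params_unique v w f (bij_inj f_bij)) => // a.
- by have := fR a; rewrite [right_nbr (surfaceB v) a]permE [right_nbr _ _]permE.
- by have := fT a; rewrite [top_nbr (surfaceB v) a]permE [top_nbr _ _]permE.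
Qed.
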